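(* Let $d\ge1$ and let $\sigma,\tau\colon\mathbb Z\to\mathbb{RP}^{2d}$ be a generic pair of autoconjugate curves of a non-degenerate quadric $\mathcal Q\subset\mathbb{RP}^{2d}$, with osculating spaces $S_{(k)}(j)$ and $T_{(k)}(i)$ respectively. Then $$P(i,j):=S_{(d-1)}(j)^\perp\cap T_{(d-1)}(i)^\perp$$ determines a generic Kœnigs $d$-grid $P\colon\mathbb Z^2\to\mathbb{RP}^{2d}$. For $k\in\{0,1,\dots,d\}$ the Laplace transforms $P_{\pm k}$ exist and are given by $$P_k(i,j)=S_{(d-k-1)}(j+k)^\perp\cap T_{(d+k-1)}(i)^\perp,\qquad P_{-k}(i,j)=T_{(d-k-1)}(i+k)^\perp\cap S_{(d+k-1)}(j)^\perp.$$
   Context: Notation: $\Sigma_m=\{0,1,\dots,m\}$, $\Sigma_{a,b}=\Sigma_a\times\Sigma_b$; $\vee$ denotes join; $P^{\mathrm h}(j)$ is the join of all $P(i,j)$ with $j$ fixed, $P^{\mathrm v}(i)$ the join of all $P(i,j)$ with $i$ fixed. By convention $\emptyset$ has dimension $-1$ and $\emptyset^\perp$ is the whole space. Curves: for $\gamma\colon\mathbb Z\to\mathbb{RP}^n$ and $0\le k\le n$ the osculating space is $C_{(k)}(j)=\gamma(j)\vee\gamma(j+1)\vee\dots\vee\gamma(j+k)$, and $C_{(-1)}(j)=\emptyset$. A curve $\gamma\colon\mathbb Z\to\mathbb{RP}^{2d}$ is autoconjugate with respect to (of) a quadric $\mathcal Q$ if every osculating space $C_{(d-1)}(i)$ is contained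 in $\mathcal Q$. A pair $\sigma,\tau\colon\mathbb Z\to\mathbb{RP}^n$ with osculating spaces $S_{(k)}(j)$, $T_{(k)}(i)$ is generic if $\dim\big(S_{(k)}(j)\vee T_{(n-k-1)}(i)\big)=n$ for all $i,j\in\mathbb Z$ and all $-1\le k\le n$. Quadrics: a quadric is the zero set of a non-zero symmetric bilinear form $\varphi$; it is non-degenerate if it is non-empty and has no singular point. For a subspace $A$, $A^\perp$ is the subspace of all $[x]$ with $\varphi(x,y)=0$ for all $[y]\in A$. Q-nets: a Q-net is a map $P$ from $\mathbb Z^2$ (or $\Sigma_{a,b}$) to $\mathbb{RP}^n$ such that the four points of every face (unit square) lie in a plane. It is non-degenerate if the points at the two ends of each edge are distinct and any three of the four points of each face span a plane. A Q-net on $\Sigma_{a,b}$ is extensive if it is non-degenerate and the join of its image is $(a+b)$-dimensional; a Q-net is $\Sigma_{d,d}$-extensive if its restriction to every translate of $\Sigma_{d,d}$ in the domain is extensive. Laplace transforms: for a non-degenerate Q-net, $\mathcal L_+P(i,j)=(P(i,j)\vee P(i,j+1))\cap(P(i+1,j)\vee P(i+1,j+1))$ and $\mathcal L_-P(i,j)=(P(i,j)\vee P(i+1,j))\cap(P(i,j+1)\vee P(i+1,j+1))$; these are Q-nets. $P_m=(\mathcal L_+)^mP$, $P_{-m}=(\mathcal L_-)^mP$; $P_{\pm m}$ exists if all preceding iterates are non-degenerate. $P_m$ is nowhere Laplace degenerate if $P_m(i,j)\ne P_m(i+1,j)$ for all $i,j$; $P_{-m}$ is nowhere Laplace degenerate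 if $P_{-m}(i,j)\ne P_{-m}(i,j+1)$ for all $i,j$. Kœnigs nets: an inscribed conic of a face of a non-degenerate Q-net is a conic in the plane of the face which is either a non-degenerate conic tangent to the four edge-lines, or the double line $P_1(i,j)\vee P_{-1}(i,j)$ (touching each edge-line in its intersection point with it); no other degenerate conics are admitted. An instance of touching conics assigns to each face an inscribed conic such that for every edge shared by two faces the two conics touch the edge-line in the same point. A Kœnigs net is a non-degenerate Q-net that admits an instance of touching conics. Grids: $P$ is a $d$-grid if all $P^{\mathrm h}(j)$ and $P^{\mathrm v}(i)$ are $d$-dimensional. A $d$-grid is generic if it is $\Sigma_{d,d}$-extensive and $P_d$ and $P_{-d}$ exist and are nowhere Laplace degenerate. A generic Kœnigs $d$-grid is a Kœnigs net that is a generic $d$-grid. *)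

(* Defs.v *)
From HB Require Import structures.
From mathcomp Require Import all_boot all_order all_algebra sesquilinear.
From mathcomp Require Import classical_sets reals.

Set Implicit Arguments.
Unset Strict Implicit.
Unset Printing Implicit Defensive.

Import Order.TTheory GRing.Theory Num.Theory.

Local Open Scope ring_scope.

(* A projective subspace of RP^n is a linear subspace of R^(n+1); join and meet
   are the sum and the intersection in %VS, and 0%VS is the empty subspace. *)
Notation subspace R n := {vspace 'rV[R]_n.+1}.
Notation symform R n := {symmetric 'rV[R]_n.+1}.

Definition pdim (R : realType) (n : nat) (U : subspace R n) : int :=
  (\dim U)%:Z - 1.

Definition is_point (R : realType) (n : nat) (U : subspace R n) : Prop :=
  pdim U = 0.

(* Join of a possibly infinite set of subspaces. *)
Definition is_join (R : realType) (n : nat) (X : set (subspace R n))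
    (U : subspace R n) : Prop :=
  (forall A, X A -> (A <= U)%VS) /\
  (forall W : subspace R n, (forall A, X A -> (A <= W)%VS) -> (U <= W)%VS).

Definition join_pdim (R : realType) (n : nat) (X : set (subspace R n))
    (m : int) : Prop :=
  exists2 U, is_join X U & pdim U = m.

(* A quadric is given by its form phi; the polar space of A is [orthov phi A]. *)

Definition nonzero_form (R : realType) (n : nat) (phi : symform R n) : Prop :=
  exists u v, phi u v != 0.

Definition in_quadric (R : realType) (n : nat) (phi : symform R n)
    (A : subspace R n) : Prop :=
  forall u, u \in A -> phi u u = 0.

(* The quadric that phi defines in the subspace U is non-empty and has no
   singular point. Only the restriction of phi to U matters. *)
Definition nondeg_quadric_in (R : realType) (n : nat) (phi : symform R n)
    (U : subspace R n) : Prop :=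
  (exists u, [/\ u \in U, u != 0 & phi u u = 0]) /\
  (forall u, u \in U -> u != 0 -> phi u u = 0 ->
     exists2 v, v \in U & phi u v != 0).

Definition nondeg_quadric (R : realType) (n : nat) (phi : symform R n) : Prop :=
  nonzero_form phi /\ nondeg_quadric_in phi fullv.

Definition is_curve (R : realType) (n : nat) (g : int -> subspace R n) : Prop :=
  forall j, is_point (g j).

(* The osculating spaces C_(k)(j); empty for k = -1, and k < -1 is not used. *)
Definition osc (R : realType) (n : nat) (g : int -> subspace R n) (k j : int) :
    subspace R n :=
  if k is Posz m then (\sum_(l < m.+1) g (j + l%:Z)%R)%VS else 0%VS.

Definition autoconjugate (R : realType) (d : nat) (phi : symform R (2 * d))
    (g : int -> subspace R (2 * d)) : Prop :=
  is_curve g /\ forall i, in_quadric phi (osc g (d%:Z - 1) i).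

Definition generic_pair (R : realType) (n : nat)
    (s t : int -> subspace R n) : Prop :=
  [/\ is_curve s, is_curve t &
      forall i j k : int, -1 <= k <= n%:Z ->
        pdim (osc s k j + osc t (n%:Z - k - 1)%R i)%VS = n%:Z].

(* A net is a map on Z^2 that is only considered on its domain D. *)

Definition Z2 : rel int := fun _ _ => true.

(* The translate of Sigma_(a,b) with lower left corner (i0, j0). *)
Definition Sigma (a b : nat) (i0 j0 : int) : rel int :=
  fun i j => (i0 <= i <= i0 + a%:Z) && (j0 <= j <= j0 + b%:Z).

Definition is_face (D : rel int) (i j : int) : bool :=
  [&& D i j, D (i + 1) j, D i (j + 1) & D (i + 1) (j + 1)].

Definition face_join (R : realType) (n : nat) (P : int -> int -> subspace R n)
    (i j : int) : subspace R n :=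
  (P i j + P (i + 1)%R j + P i (j + 1)%R + P (i + 1)%R (j + 1)%R)%VS.

Definition Qnet (R : realType) (n : nat) (D : rel int)
    (P : int -> int -> subspace R n) : Prop :=
  (forall i j, D i j -> is_point (P i j)) /\
  (forall i j, is_face D i j ->
     exists2 U : subspace R n, pdim U = 2 & (face_join P i j <= U)%VS).

Definition nondeg_Qnet (R : realType) (n : nat) (D : rel int)
    (P : int -> int -> subspace R n) : Prop :=
  [/\ Qnet D P,
      forall i j, D i j -> D (i + 1) j -> P i j <> P (i + 1) j,
      forall i j, D i j -> D i (j + 1) -> P i j <> P i (j + 1) &
      forall i j, is_face D i j ->
        [/\ pdim (P i j + P (i + 1)%R j + P i (j + 1)%R)%VS = 2,
            pdim (P i j + P (i + 1)%R j + P (i + 1)%R (j + 1)%R)%VS = 2,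
            pdim (P i j + P i (j + 1)%R + P (i + 1)%R (j + 1)%R)%VS = 2 &
            pdim (P (i + 1)%R j + P i (j + 1)%R + P (i + 1)%R (j + 1)%R)%VS
              = 2]].

(* The restriction of P to the translate of Sigma_(a,b) at (i0, j0) is
   extensive. *)
Definition extensive (R : realType) (n : nat) (a b : nat) (i0 j0 : int)
    (P : int -> int -> subspace R n) : Prop :=
  nondeg_Qnet (Sigma a b i0 j0) P /\
  join_pdim (fun A => exists i j, Sigma a b i0 j0 i j /\ A = P i j)
    (a + b)%N%:Z.

Definition Sigma_extensive (R : realType) (n : nat) (d : nat)
    (P : int -> int -> subspace R n) : Prop :=
  forall i0 j0, extensive d d i0 j0 P.

(* Laplace transforms are total on subspace-valued maps, but their values are
   points only for a non-degenerate Q-net. *)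

Definition Lplus (R : realType) (n : nat) (P : int -> int -> subspace R n) :
    int -> int -> subspace R n :=
  fun i j => ((P i j + P i (j + 1)%R) :&:
              (P (i + 1)%R j + P (i + 1)%R (j + 1)%R))%VS.

Definition Lminus (R : realType) (n : nat) (P : int -> int -> subspace R n) :
    int -> int -> subspace R n :=
  fun i j => ((P i j + P (i + 1)%R j) :&:
              (P i (j + 1)%R + P (i + 1)%R (j + 1)%R))%VS.

Definition laplace_exists (R : realType) (n : nat)
    (L : (int -> int -> subspace R n) -> int -> int -> subspace R n)
    (m : nat) (P : int -> int -> subspace R n) : Prop :=
  forall l, (l < m)%N -> nondeg_Qnet Z2 (iter l L P).

(* A conic in a plane U of RP^n is given by a form on the
   ambient space, of which only the restriction to U is relevant; every
   symmetric bilinear form on U is such a restriction. *)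

(* phi defines in U the double line m: its equation in U is f^2 = 0 for a
   linear form f that vanishes exactly on m. *)
Definition double_line (R : realType) (n : nat) (phi : symform R n)
    (U m : subspace R n) : Prop :=
  exists (c : R) (f : 'Hom('rV[R]_n.+1, R^o)),
    [/\ c != 0, (U :&: lker f)%VS = m &
        forall u v, u \in U -> v \in U -> phi u v = c * (f u * f v)].

(* The conic touches the line l in the point x. The conditions imply that x is
   on the conic. If the conic is the double line f^2 = 0 and f does not vanish
   on l, then x is the intersection point of l with the line f = 0. *)
Definition touches (R : realType) (n : nat) (phi : symform R n)
    (l x : subspace R n) : Prop :=
  [/\ is_point x, (x <= l)%VS & (l <= orthov phi x)%VS].

Definition tangent (R : realType) (n : nat) (phi : symform R n)
    (l : subspace R n) : Prop :=
  exists x, touches phi l x.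

Definition inscribed_conic (R : realType) (n : nat)
    (P : int -> int -> subspace R n) (i j : int) (phi : symform R n) : Prop :=
  (nondeg_quadric_in phi (face_join P i j) /\
   [/\ tangent phi (P i j + P (i + 1)%R j)%VS,
       tangent phi (P i (j + 1)%R + P (i + 1)%R (j + 1)%R)%VS,
       tangent phi (P i j + P i (j + 1)%R)%VS &
       tangent phi (P (i + 1)%R j + P (i + 1)%R (j + 1)%R)%VS])
  \/ double_line phi (face_join P i j) (Lplus P i j + Lminus P i j)%VS.

(* An inscribed conic touches each edge-line in exactly one point, so a common
   point of contact means that the points of contact agree. *)
Definition touching_conics (R : realType) (n : nat) (D : rel int)
    (P : int -> int -> subspace R n) (C : int -> int -> symform R n) : Prop :=
  [/\ forall i j, is_face D i j -> inscribed_conic P i j (C i j),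
      forall i j, is_face D i j -> is_face D (i + 1) j ->
        let edge := (P (i + 1)%R j + P (i + 1)%R (j + 1)%R)%VS in
        exists x, touches (C i j) edge x /\ touches (C (i + 1) j) edge x &
      forall i j, is_face D i j -> is_face D i (j + 1) ->
        let edge := (P i (j + 1)%R + P (i + 1)%R (j + 1)%R)%VS in
        exists x, touches (C i j) edge x /\ touches (C i (j + 1)) edge x].

Definition koenigs_net (R : realType) (n : nat) (D : rel int)
    (P : int -> int -> subspace R n) : Prop :=
  nondeg_Qnet D P /\ exists C, touching_conics D P C.

Definition is_grid (R : realType) (n : nat) (d : nat)
    (P : int -> int -> subspace R n) : Prop :=
  [/\ Qnet Z2 P,
      forall j, join_pdim (range (fun i => P i j)) d%:Z &
      forall i, join_pdim (range (fun j => P i j)) d%:Z].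

Definition generic_grid (R : realType) (n : nat) (d : nat)
    (P : int -> int -> subspace R n) : Prop :=
  [/\ is_grid d P,
      Sigma_extensive d P,
      laplace_exists (@Lplus R n) d P /\
        (forall i j, iter d (@Lplus R n) P i j
                       <> iter d (@Lplus R n) P (i + 1) j) &
      laplace_exists (@Lminus R n) d P /\
        (forall i j, iter d (@Lminus R n) P i j
                       <> iter d (@Lminus R n) P i (j + 1))].

Definition generic_koenigs_grid (R : realType) (n : nat) (d : nat)
    (P : int -> int -> subspace R n) : Prop :=
  koenigs_net Z2 P /\ generic_grid d P.

(* Main.v *)
Require Import Defs.
From HB Require Import structures.
From mathcomp Require Import all_boot all_order all_algebra sesquilinear.
From mathcomp Require Import classical_sets reals.
From mathcomp Require Import boolp zify ring.

Set Implicit Arguments.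
Unset Strict Implicit.
Unset Printing Implicit Defensive.

Import Order.TTheory GRing.Theory Num.Theory.

(** P(i,j) is the polar point of the join of S_(d-1)(j) and T_(d-1)(i), and the
    polar of A :&: B is the join of the polars of A and B.  By genericity, any
    consecutive points of sigma together with any consecutive points of tau, at
    most 2d+1 in all, are independent, so joins and meets of the points of P
    correspond to meets and joins of runs of sigma and tau, and all incidences
    and Laplace transforms follow by counting dimensions.

    The conics are the sections of the quadric by the face planes.  An edge-line
    is the polar of A + B with A and B isotropic, one of dimension d-1 and the
    other, say B, of dimension d; a vector of B orthogonal to A spans a point of
    contact, and it depends on the edge only.  A face plane is the polar of
    A + B with A and B isotropic of equal dimension d-1, so the radical of phi
    on it splits into two kernels of the same dimension.  These kernels are
    contained in P_1(i,j) and P_(-1)(i,j), so phi is non-degenerate on the plane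
    or defines the double line joining these two points. *)

Local Open Scope ring_scope.

(** * Polar spaces *)

Section Polarity.
Variables (F : fieldType) (vT : vectType F) (phi : {symmetric vT}).
Implicit Types A B C U p q : {vspace vT}.

Lemma addvACA : @interchange {vspace vT} addv addv.
Proof. exact: Monoid.mulmACA. Qed.

Lemma form_sym u v : phi u v = phi v u.
Proof. by rewrite hermC expr0 mul1r. Qed.

Lemma orthov_add A B : orthov phi (A + B) = (orthov phi A :&: orthov phi B)%VS.
Proof.
apply/vspaceP => u; rewrite memv_cap.
by rewrite !memvE orthovD.
Qed.

Lemma orthovS A B : (A <= B)%VS -> (orthov phi B <= orthov phi A)%VS.
Proof.
move=> sAB; rewrite orthov_sym (subv_trans sAB) //.
by rewrite orthov_sym.
Qed.

Lemma sub_orthovK A : (A <= orthov phi (orthov phi A))%VS.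
Proof. by rewrite orthov_sym. Qed.

(** Each vector of a basis of [A] imposes one linear condition on [U]. *)
Lemma leq_dim_capv_orthov U A :
  (\dim U <= \dim (U :&: orthov phi A) + \dim A)%N.
Proof.
suff spanP X : (\dim U <= \dim (U :&: orthov phi <<X>>) + size X)%N.
  by have := spanP (vbasis A); rewrite (span_basis (vbasisP A)) size_tuple.
elim: X => [|x X IH]; first by rewrite span_nil orthov0 capvf addn0.
apply: leq_trans IH _; rewrite span_cons orthov_add (capvC (orthov _ _)) capvA.
have := leq_dim_orthov1 phi x (U :&: orthov phi <<X>>)%VS.
by rewrite /=; lia.
Qed.

Hypothesis phi_nondeg : orthov phi fullv = 0%VS.

(* A meets the polar of a complement of orthov phi A only in the radical of
   phi, which bounds its dimension by the codimension of orthov phi A. *)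
Lemma dim_orthov A : (\dim (orthov phi A) + \dim A)%N = \dim {:vT}.
Proof.
apply/eqP; rewrite eqn_leq; apply/andP; split; last first.
  by have := leq_dim_capv_orthov fullv A; rewrite capfv.
have := leq_dim_capv_orthov A (orthov phi A)^C.
suff -> : (A :&: orthov phi (orthov phi A)^C)%VS = 0%VS.
  rewrite dimv0 dimv_compl; have := dimvS (subvf (orthov phi A)); lia.
apply/eqP; rewrite -subv0 -phi_nondeg -(addv_complf (orthov phi A)) orthov_add.
by rewrite capvS // sub_orthovK.
Qed.

Lemma orthovK A : orthov phi (orthov phi A) = A.
Proof.
apply/esym/eqP; rewrite eqEdim sub_orthovK /=.
by have := dim_orthov A; have := dim_orthov (orthov phi A); lia.
Qed.

(** [C] lies in the meet of [A] and [B], and [D] in their join. The dimension bound forces equality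
    in both, so [C] is the meet, and the polar of a meet is the join of the polars. *)
Lemma orthov_join A B C D :
    (C <= A)%VS -> (C <= B)%VS -> (D <= A + B)%VS ->
    (\dim A + \dim B <= \dim D + \dim C)%N ->
  (orthov phi A + orthov phi B)%VS = orthov phi C.
Proof.
move=> sCA sCB sDAB dimAB; apply/eqP.
rewrite eqEdim subv_add !orthovS //=.
have := dimv_sum_cap (orthov phi A) (orthov phi B); rewrite -orthov_add.
have := dim_orthov A; have := dim_orthov B; have := dim_orthov C.
by have := dim_orthov (A + B)%VS; have := dimvS sDAB; lia.
Qed.

(** Both sides are [\dim A + \dim B] minus the rank of the pairing of [A] with [B]. *)
Lemma dim_capv_orthovC A B :
  (\dim (A :&: orthov phi B) + \dim B)%N
    = (\dim (B :&: orthov phi A) + \dim A)%N.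
Proof.
have := dimv_sum_cap A (orthov phi B).
have := dim_orthov (A + orthov phi B)%VS; rewrite orthov_add orthovK capvC.
by have := dim_orthov B; lia.
Qed.

(** If [a + b] is orthogonal to [A] and [B], isotropy of [A] makes [b] orthogonal to [A], and
    isotropy of [B] makes [a] orthogonal to [B]. *)
Lemma isotropic_join_radical A B :
    (A <= orthov phi A)%VS -> (B <= orthov phi B)%VS ->
  ((A + B) :&: orthov phi (A + B)
     <= (A :&: orthov phi B) + (B :&: orthov phi A))%VS.
Proof.
move=> isoA isoB; apply/subvP => w; rewrite memv_cap.
case/andP=> /memv_addP[a aA [b bB ->]].
rewrite orthov_add memv_cap => /andP[oA oB].
apply: memv_add; rewrite memv_cap ?aA ?bB /=.
  by rewrite -[a](addrK b) memvB // (subvP isoB).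
by rewrite -[b](addKr a) memvD // memvN (subvP isoA).
Qed.

(* The radical of phi on U is the sum of two spaces of equal dimension, so phi
   has rank 3 or 1 on the 3-dimensional space U. *)
Lemma radical_dichotomy A B p q :
    (A <= orthov phi A)%VS -> (B <= orthov phi B)%VS ->
    (A :&: B)%VS = 0%VS -> \dim A = \dim B ->
    \dim (orthov phi (A + B)) = 3%N -> \dim p = 1%N -> \dim q = 1%N ->
    (B :&: orthov phi A <= p)%VS -> (A :&: orthov phi B <= q)%VS ->
  (orthov phi (A + B) :&: (A + B))%VS = 0%VS \/
  [/\ (p + q <= orthov phi (A + B))%VS, \dim (p + q) = 2%N,
      (p + q <= orthov phi (orthov phi (A + B)))%VS &
      ~~ (orthov phi (A + B) <= orthov phi (orthov phi (A + B)))%VS].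
Proof.
move=> isoA isoB AB0 dimAB dimU dimp dimq sp sq.
have rad_sub := isotropic_join_radical isoA isoB.
have dim_st := dim_capv_orthovC A B.
have := dimvS sp; have := dimvS sq; rewrite dimp dimq => dims dimt.
(* The two kernels have the same dimension, at most 1: either both vanish, or each fills the point
   that contains it. *)
have [s0|s_pos] := posnP (\dim (A :&: orthov phi B)).
  left; apply/eqP; rewrite -dimv_eq0 -leqn0 capvC.
  apply: leq_trans (dimvS rad_sub) _; apply: leq_trans (dimv_add_leqif _ _) _.
  by lia.
have eq_p : (B :&: orthov phi A)%VS = p by apply/eqP; rewrite eqEdim sp; lia.
have eq_q : (A :&: orthov phi B)%VS = q by apply/eqP; rewrite eqEdim sq; lia.
have dimpq : \dim (p + q) = 2%N.
  rewrite dimv_disjoint_sum ?dimp ?dimq // -eq_p -eq_q; apply/eqP.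
  rewrite -subv0 -AB0 subv_cap (subv_trans (capvSr _ _)) ?capvSl //.
  by rewrite (subv_trans (capvSl _ _)) ?capvSl.
have pqAB : (p + q <= A + B)%VS.
  by rewrite -eq_p -eq_q addvC addvS ?capvSl.
have pqU : (p + q <= orthov phi (A + B))%VS.
  rewrite orthov_add -eq_p -eq_q subv_cap !subv_add !capvSr andbT /=.
  by rewrite (subv_trans (capvSl _ _) isoA) (subv_trans (capvSl _ _) isoB).
right; split=> //; first by rewrite orthovK.
(* Were the 3-dimensional polar space isotropic, it would lie in the radical, hence in the
   2-dimensional [p + q]. *)
rewrite orthovK //; apply/negP => sUAB.
have : (orthov phi (A + B) <= p + q)%VS.
  apply: subv_trans (subv_trans _ rad_sub) _; first by rewrite subv_cap sUAB /=.
  by rewrite eq_p eq_q addvC.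
by move/dimvS; rewrite dimpq dimU.
Qed.

End Polarity.

(** * Sections of a quadric by planes *)

Section Conics.
Variables (R : realType) (n : nat) (phi : symform R n).
Implicit Types A B U : subspace R n.

Lemma is_pointE U : is_point U <-> \dim U = 1%N.
Proof. rewrite /is_point /pdim; split; move: (\dim U) => m; lia. Qed.

(** By dimension some non-zero [t] in [B] is orthogonal to [A]. Isotropy of [B] puts it in the polar
    of [A + B], which is orthogonal to [t] because [t] is in [B]. *)
Lemma touches_polar A B :
    (B <= orthov phi B)%VS -> (\dim A < \dim B)%N ->
  exists x, touches phi (orthov phi (A + B)) x.
Proof.
move=> isoB ltAB.
have := leq_dim_capv_orthov phi B A.
case: (eqVneq (B :&: orthov phi A)%VS 0%VS) => [->|nz _].
  by rewrite dimv0 add0n leqNgt ltAB.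
have := memv_pick (B :&: orthov phi A)%VS; move: nz.
rewrite -vpick0; set t := vpick _ => t0 tBA.
have [tB tA] : (<[t]> <= B)%VS /\ (<[t]> <= orthov phi A)%VS.
  by apply/andP; rewrite -subv_cap -memvE.
have tAB : (<[t]> <= orthov phi (A + B))%VS.
  by rewrite orthov_add subv_cap tA (subv_trans tB).
exists <[t]>%VS; split=> //.
  by apply/is_pointE; rewrite dim_vline t0.
by rewrite orthovS // (subv_trans tB) // addvSr.
Qed.

(** For any [u0] in [U] outside [m], the form on [U] is [f u * f v / phi u0 u0] with
    [f u = phi u u0]. *)
Lemma double_line_radical U (m : subspace R n) :
    (m <= U)%VS -> (\dim m).+1 = \dim U -> (m <= orthov phi U)%VS ->
    ~~ (U <= orthov phi U)%VS ->
  double_line phi U m.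
Proof.
move=> smU dimm radm nisoU.
have [u0 u0U u0n] : exists2 u0, u0 \in U & u0 \notin m.
  by apply/subvPn; apply: contra nisoU => /subv_trans; apply.
have defU : U = (m + <[u0]>)%VS.
  apply/eqP; rewrite eq_sym eqEdim subv_add smU -memvE u0U /=.
  rewrite dimv_disjoint_sum; last first.
    apply/eqP; rewrite -subv0; apply/subvP => w; rewrite memv_cap memv0.
    case/andP=> wm /vlineP[k def_w]; rewrite def_w scaler_eq0.
    apply: contraNT u0n; rewrite negb_or => /andP[k0 _].
    by rewrite -[u0](scalerK k0) -def_w memvZ.
  rewrite dim_vline; case: eqVneq u0n => [->|_ _]; first by rewrite mem0v.
  by rewrite addn1 dimm.
have m0 u v : u \in m -> v \in U -> phi u v = 0.
  by move=> um vU; apply: (orthovP radm).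
have phi00 : phi u0 u0 != 0.
  apply: contra nisoU => /eqP phi00; apply/orthovP => u v.
  rewrite {1}defU => /memv_addP[u1 u1m [_ /vlineP[a ->] ->]] vU.
  rewrite linearDl /= linearZl /= m0 // add0r.
  move: vU; rewrite defU => /memv_addP[v1 v1m [_ /vlineP[b ->] ->]].
  by rewrite linearDr /= linearZr /= phi00 form_sym m0 // !(mulr0, addr0).
pose f : 'Hom('rV[R]_n.+1, R^o) := linfun (applyr phi u0 : 'rV[R]_n.+1 -> R^o).
have fE u : f u = phi u u0 by rewrite lfunE.
exists (phi u0 u0)^-1, f; split; first by rewrite invr_eq0.
- apply/vspaceP => u; rewrite memv_cap memv_ker fE.
  apply/andP/idP => [[]|um]; last by rewrite (subvP smU) // m0.
  rewrite {1}defU => /memv_addP[u1 u1m [_ /vlineP[a ->] ->]].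
  rewrite linearDl /= linearZl /= m0 // add0r mulf_eq0 (negPf phi00) orbF.
  by move=> /eqP->; rewrite scale0r addr0.
- move=> u v; rewrite !fE {1}defU => /memv_addP[u1 u1m [_ /vlineP[a ->] ->]].
  rewrite {1}defU => /memv_addP[v1 v1m [_ /vlineP[b ->] ->]].
  have m0r w : w \in m -> phi u0 w = 0 by move=> wm; rewrite form_sym m0.
  rewrite !(linearDl, linearDr, linearZl, linearZr) /=.
  rewrite !(m0 u1, m0 v1, m0r v1) //.
    by rewrite !(mulr0, add0r, addr0); field.
  exact: (subvP smU).
Qed.

(** The contact point shows that the quadric is non-empty; a singular point would lie in the
    radical. *)
Lemma nondeg_quadric_in_radical0 U l x :
    (l <= U)%VS -> touches phi l x -> (U :&: orthov phi U)%VS = 0%VS ->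
  nondeg_quadric_in phi U.
Proof.
move=> slU [/is_pointE dimx xl lx] rad0; split.
  exists (vpick x); split.
  - exact: subvP (subv_trans xl slU) _ (memv_pick x).
  - by rewrite vpick0 -dimv_eq0 dimx.
  - by have /orthovP := subv_trans xl lx; apply; apply: memv_pick.
move=> w wU w0 _; apply/mem_orthovPn; apply: contra w0 => wUo.
by rewrite -memv0 -rad0 memv_cap wU.
Qed.

End Conics.

(** * Runs of consecutive points of two curves *)

Section Arcs.
Variables (R : realType) (n : nat).
Implicit Types (g s t : int -> subspace R n) (i j : int).

(** Indexed by the number of points, so that lengths stay in [nat] and length 0 is the empty
    space. *)
Definition arc g (m : nat) j : subspace R n := (\sum_(l < m) g (j + l%:Z)%R)%VS.

Lemma oscE g m j : osc g (m%:Z - 1) j = arc g m j.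
Proof.
case: m => [|m]; first by rewrite /arc big_ord0.
by rewrite -[m.+1]addn1 PoszD addrK addn1.
Qed.

Lemma arc0 g j : arc g 0 j = 0%VS.
Proof. by rewrite /arc big_ord0. Qed.

Lemma arcSl g m j : arc g m.+1 j = (g j + arc g m (j + 1)%R)%VS.
Proof.
rewrite /arc big_ord_recl addr0; congr (_ + _)%VS.
by apply: eq_bigr => l _; rewrite lift0; congr (g _); lia.
Qed.

Lemma arcSr g m j : arc g m.+1 j = (arc g m j + g (j + m%:Z)%R)%VS.
Proof. by rewrite /arc big_ord_recr. Qed.

Lemma arcD g a b j : arc g (a + b) j = (arc g a j + arc g b (j + a%:Z)%R)%VS.
Proof.
elim: b => [|b IH]; first by rewrite addn0 arc0 addv0.
by rewrite addnS !arcSr IH PoszD addvA addrA.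
Qed.

Lemma arc_subl g m j : (arc g m j <= arc g m.+1 j)%VS.
Proof. by rewrite arcSr addvSl. Qed.

Lemma arc_subr g m j : (arc g m (j + 1)%R <= arc g m.+1 j)%VS.
Proof. by rewrite arcSl addvSr. Qed.

Lemma arc_join g m j :
  (arc g m.+1 j + arc g m.+1 (j + 1)%R)%VS = arc g m.+2 j.
Proof.
apply/eqP; rewrite eqEsubv subv_add arc_subl arc_subr /=.
by rewrite arcSl addvS // arcSl addvSl.
Qed.

(** Laplace transforms move the start of one curve. Absorbing this into the curve keeps them in the
    family [net], so that they can be iterated. *)
Definition shift (k : nat) g : int -> subspace R n := fun j => g (j + k%:Z).

Lemma arc_shift k g m j : arc (shift k g) m j = arc g m (j + k%:Z).
Proof. by apply: eq_bigr => l _; rewrite /shift addrAC. Qed.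

Lemma shift_shift k l g : shift k (shift l g) = shift (k + l) g.
Proof. by apply: funext => j; rewrite /shift PoszD addrA. Qed.

Definition independent s t := forall (a b : nat) j i, (a + b <= n.+1)%N ->
  \dim (arc s a j + arc t b i) = (a + b)%N.

Lemma independentC s t : independent s t -> independent t s.
Proof. by move=> st a b j i; rewrite addvC addnC; apply: st. Qed.

Lemma independent_shift k s t : independent s t -> independent (shift k s) t.
Proof. by move=> st a b j i; rewrite arc_shift; apply: st. Qed.

Lemma leq_dim_arc g m j : is_curve g -> (\dim (arc g m j) <= m)%N.
Proof.
move=> g1; elim: m => [|m IH]; first by rewrite arc0 dimv0.
rewrite arcSr; apply: leq_trans (dimv_add_leqif _ _) _.
by rewrite -[m.+1]addn1 leq_add // (is_pointE _).1.
Qed.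

(** Genericity concerns [n.+1] points in all. Lengthening the run of [s] by [c] points reaches this
    number; each point adds at most 1 to the dimension, so the shorter runs are independent too. *)
Lemma generic_pair_independent s t : generic_pair s t -> independent s t.
Proof.
case=> s1 t1 st a b j i leabn.
have [c def_n] : exists c, (a + c + b = n.+1)%N.
  by exists (n.+1 - b - a)%N; lia.
have := st i j ((a + c)%N%:Z - 1); rewrite oscE.
have -> : n%:Z - ((a + c)%N%:Z - 1) - 1 = b%:Z - 1 by lia.
rewrite oscE /pdim arcD -addvA (addvC (arc s c _)) addvA => dimn.
have {}dimn : \dim (arc s a j + arc t b i + arc s c (j + a%:Z)%R) = n.+1.
  by move: dimn; set m := \dim _ => /(_ ltac:(lia)); lia.
have := (dimv_add_leqif (arc s a j + arc t b i) (arc s c (j + a%:Z)%R)).1.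
have := (dimv_add_leqif (arc s a j) (arc t b i)).1.
have := leq_dim_arc a j s1; have := leq_dim_arc b i t1.
have := leq_dim_arc c (j + a%:Z) s1; rewrite dimn; lia.
Qed.

End Arcs.

(** * Polar nets of a pair of curves *)

Section Nets.
Variables (R : realType) (n : nat) (phi : symform R n).
Hypothesis phi_nondeg : orthov phi fullv = 0%VS.
Implicit Types (s t : int -> subspace R n) (a b : nat) (i j : int).

(** For independent curves, [a + b] equal to [n], [n - 1] or [n - 2] gives points, lines or planes:
    vertices, edge-lines and face planes all have this form. *)
Definition net s t a b i j : subspace R n :=
  orthov phi (arc s a j + arc t b i).

Lemma netC s t a b i j : net s t a b i j = net t s b a j i.
Proof. by rewrite /net addvC. Qed.

Lemma net_shift s t k a b i j :
  net (shift k s) t a b i j = net s t a b i (j + k%:Z).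
Proof. by rewrite /net arc_shift. Qed.

Lemma dim_net s t a b c i j : independent s t -> (a + b + c)%N = n.+1 ->
  \dim (net s t a b i j) = c.
Proof.
move=> st abc; have := dim_orthov phi_nondeg (arc s a j + arc t b i).
rewrite st; last by lia.
rewrite dimvf dim_matrix /net; set m := \dim _; lia.
Qed.

(** Neighbouring runs of [s] meet in a run one shorter and join to a run one longer. Of the nested
    runs of [t] the smaller enters the meet, the larger the join. Equal runs of [t] yield
    edge-lines, unequal ones face planes. *)
Lemma net_join_sub s t a b1 i1 b2 i2 j : independent s t ->
    (arc t b1 i1 <= arc t b2 i2)%VS -> (a.+1 + b2 <= n)%N -> (b1 <= b2)%N ->
  (net s t a.+1 b1 i1 j + net s t a.+1 b2 i2 (j + 1)%R)%VS
      = net s t a b1 i1 (j + 1) /\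
  (net s t a.+1 b2 i2 j + net s t a.+1 b1 i1 (j + 1)%R)%VS
      = net s t a b1 i1 (j + 1).
Proof.
move=> st sub_t lea2 le12.
have dimD : \dim (arc s a.+2 j + arc t b2 i2) = (a.+2 + b2)%N by apply: st; lia.
have dimS b i j' : (b <= b2)%N ->
    \dim (arc s a.+1 j' + arc t b i) = (a.+1 + b)%N.
  by move=> leb; apply: st; lia.
have dimC : \dim (arc s a (j + 1) + arc t b1 i1) = (a + b1)%N by apply: st; lia.
split; apply: (orthov_join phi_nondeg (D := (arc s a.+2 j + arc t b2 i2)%VS)).
- by apply: addvS; [exact: arc_subr | exact: subvv].
- by apply: addvS; [exact: arc_subl | exact: sub_t].
- by rewrite addvACA arc_join; apply: addvS; [exact: subvv | exact: addvSr].
- by rewrite dimD dimC !dimS; lia.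
- by apply: addvS; [exact: arc_subr | exact: sub_t].
- by apply: addvS; [exact: arc_subl | exact: subvv].
- by rewrite addvACA arc_join; apply: addvS; [exact: subvv | exact: addvSl].
- by rewrite dimD dimC !dimS; lia.
Qed.

Lemma net_joinj s t a b i j : independent s t -> (a.+1 + b <= n)%N ->
  (net s t a.+1 b i j + net s t a.+1 b i (j + 1)%R)%VS
    = net s t a b i (j + 1).
Proof. by move=> st lea; apply: (net_join_sub j st (subvv _) lea _).1. Qed.

Lemma net_joini s t a b i j : independent s t -> (a + b.+1 <= n)%N ->
  (net s t a b.+1 i j + net s t a b.+1 (i + 1)%R j)%VS
    = net s t a b (i + 1) j.
Proof.
move=> st leabn; rewrite !(netC s t) net_joinj //; last by lia.
exact: independentC.
Qed.

(** * Laplace transforms of polar nets *)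

Lemma Lplus_net s t a b : independent s t -> (0 < b)%N -> (a.+1 + b)%N = n ->
  Lplus (net s t a.+1 b) = net (shift 1 s) t a b.+1.
Proof.
move=> st b_gt0 abn; apply: funext => i; apply: funext => j.
(* Each join shortens the run of [s]; the meet of the two lines lengthens that of [t], by
   [arc_join], which requires non-empty runs. *)
rewrite /Lplus !net_joinj ?abn // -orthov_add net_shift.
case: b b_gt0 {abn} => // b _.
by rewrite addvACA addvv arc_join.
Qed.

Lemma iter_Lplus_net s t a b k : independent s t -> (0 < b)%N ->
    (a + b)%N = n -> (k <= a)%N ->
  iter k (@Lplus R n) (net s t a b) = net (shift k s) t (a - k) (b + k).
Proof.
move=> + + + + ; elim: k => [|k IH] in s a b *.
  move=> _ _ _ _; rewrite subn0 addn0 /=.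
  by congr (net _ _ _ _); apply: funext => j; rewrite /shift addr0.
case: a => // a st b_gt0 abn lekb.
rewrite iterSr Lplus_net // IH ?shift_shift ?addn1 ?subSS ?addSnnS //.
- exact: independent_shift.
- by lia.
Qed.

(** Exchanging the coordinates interchanges the two transforms, so facts on [Lminus] follow from
    those on [Lplus] with the curves swapped. *)
Lemma iter_Lminus_Lplus (P : int -> int -> subspace R n) k :
  iter k (@Lminus R n) P
    = fun i j => iter k (@Lplus R n) (fun i' j' => P j' i') j i.
Proof. by elim: k => // k IH; rewrite iterS IH. Qed.

Lemma iter_Lminus_net s t a b k : independent s t -> (0 < a)%N ->
    (a + b)%N = n -> (k <= b)%N ->
  iter k (@Lminus R n) (net s t a b) = net s (shift k t) (a + k) (b - k).
Proof.
move=> st a_gt0 abn lekb; rewrite iter_Lminus_Lplus.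
have -> : (fun i j => net s t a b j i) = net t s b a.
  by apply: funext => i; apply: funext => j; rewrite netC.
rewrite iter_Lplus_net ?(addnC b) //; last exact: independentC.
by apply: funext => i; apply: funext => j; rewrite netC.
Qed.

(** * Non-degeneracy and face planes *)

Lemma net_neqj s t a b i j : independent s t -> (a + b)%N = n -> (0 < a)%N ->
  net s t a b i j <> net s t a b i (j + 1).
Proof.
move=> st abn; case: a abn => // a abn _ eq_ij.
have := net_joinj i j st (eq_leq abn); rewrite -eq_ij addvv => eq_net.
have abn1 : (a.+1 + b + 1)%N = n.+1 by lia.
have abn2 : (a + b + 2)%N = n.+1 by lia.
by have := dim_net i j st abn1; rewrite eq_net (dim_net _ _ st abn2).
Qed.

Lemma net_neqi s t a b i j : independent s t -> (a + b)%N = n -> (0 < b)%N ->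
  net s t a b i j <> net s t a b (i + 1) j.
Proof.
move=> st abn b_gt0; rewrite !(netC s t); apply: net_neqj => //.
  exact: independentC.
by rewrite addnC.
Qed.

(** Every triple contains an edge, whose line is joined with the third vertex by [net_join_sub]. *)
Lemma net_triples s t a b i j (P := net s t a.+1 b.+1)
    (U := net s t a b (i + 1) (j + 1)) :
    independent s t -> (a.+1 + b.+1)%N = n ->
  [/\ (P i j + P (i + 1)%R j + P i (j + 1)%R)%VS = U,
      (P i j + P (i + 1)%R j + P (i + 1)%R (j + 1)%R)%VS = U,
      (P i j + P i (j + 1)%R + P (i + 1)%R (j + 1)%R)%VS = U &
      (P (i + 1)%R j + P i (j + 1)%R + P (i + 1)%R (j + 1)%R)%VS = U].
Proof.
move=> st abn; rewrite /P /U.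
have Pi j' := net_joini i j' st (eq_leq abn).
have Pj i' := net_joinj i' j st (eq_leq abn).
have ts := independentC st.
have ban : (b.+1 + a.+1 <= n)%N by rewrite addnC abn.
split.
- by rewrite Pi (net_join_sub j st (arc_subr t b i) (eq_leq abn) (leqnSn b)).1.
- rewrite Pi.
  by rewrite (net_join_sub j st (arc_subl _ _ _) (eq_leq abn) (leqnSn b)).1.
- rewrite Pj !(netC s t).
  by rewrite (net_join_sub i ts (arc_subl s a (j + 1)) ban (leqnSn a)).1.
- rewrite -addvA [X in (_ + X)%VS]addvC addvA Pj addvC !(netC s t).
  by rewrite (net_join_sub i ts (arc_subl s a (j + 1)) ban (leqnSn a)).2.
Qed.

Lemma nondeg_Qnet_net s t a b : independent s t -> (a.+1 + b.+1)%N = n ->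
  nondeg_Qnet Z2 (net s t a.+1 b.+1).
Proof.
move=> st abn; have abn1 : (a.+1 + b.+1 + 1)%N = n.+1 by lia.
have dimU i j : pdim (net s t a b i j) = 2.
  have abn3 : (a + b + 3)%N = n.+1 by lia.
  by rewrite /pdim (dim_net _ _ st abn3).
split.
- split=> [i j _|i j _]; first by apply/is_pointE; apply: dim_net st abn1.
  have [E1 _ _ E4] := net_triples i j st abn.
  exists (net s t a b (i + 1) (j + 1)); first exact: dimU.
  by rewrite /face_join E1 subv_add subvv -E4 addvSr.
- by move=> i j _ _; apply: net_neqi.
- by move=> i j _ _; apply: net_neqj.
- by move=> i j _; have [-> -> -> ->] := net_triples i j st abn; rewrite dimU.
Qed.

Lemma face_join_net s t a b i j : independent s t -> (a.+1 + b.+1)%N = n ->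
  face_join (net s t a.+1 b.+1) i j = net s t a b (i + 1) (j + 1).
Proof.
move=> st abn; have [E1 _ _ E4] := net_triples i j st abn.
rewrite /face_join E1; apply/eqP.
by rewrite eqEsubv subv_add subvv addvSl -E4 addvSr.
Qed.

(** * Joins of rows, columns and rectangles *)

(** Joining neighbours leaves one space fewer, with runs of [t] one shorter; after [m] rounds a
    single space remains. *)
Lemma net_growi s t a b m i j (W : subspace R n) :
    independent s t -> (a + (b + m) <= n)%N ->
    (forall l, (l <= m)%N -> (net s t a (b + m) (i + l%:Z)%R j <= W)%VS) ->
  (net s t a b (i + m%:Z)%R j <= W)%VS.
Proof.
move=> st; elim: m i => [|m IH] i lem sW.
  by have := sW 0 (leqnn 0); rewrite addn0.
have -> : i + m.+1%:Z = i + 1 + m%:Z by lia.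
apply: IH => [|l lel]; first by lia.
rewrite addrAC -net_joini //; last by rewrite -addnS.
rewrite -addnS subv_add sW /=; last by lia.
have -> : i + l%:Z + 1 = i + l.+1%:Z by lia.
by apply: sW; lia.
Qed.

Lemma net_growj s t a b m i j (W : subspace R n) :
    independent s t -> (a + m + b <= n)%N ->
    (forall l, (l <= m)%N -> (net s t (a + m) b i (j + l%:Z)%R <= W)%VS) ->
  (net s t a b i (j + m%:Z)%R <= W)%VS.
Proof.
move=> st lem sW; rewrite netC; apply: net_growi => [||l lel].
- exact: independentC.
- by rewrite addnC.
- by rewrite -netC sW.
Qed.

Lemma join_pdim_row s t a b j : independent s t -> (a + b)%N = n ->
  join_pdim (range (fun i => net s t a b i j)) b%:Z.
Proof.
move=> st abn; exists (net s t a 0 0 j); last first.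
  have abn1 : (a + 0 + b.+1)%N = n.+1 by lia.
  by rewrite /pdim (dim_net _ _ st abn1); lia.
split=> [_ [i _ <-]|W sW].
  by rewrite /net !orthov_add capvS // orthovS // arc0 sub0v.
rewrite /net arc0 -(arc0 t (0 + b%:Z)).
by apply: net_growi => // [|l _]; [lia | apply: sW; exists (0 + l%:Z)].
Qed.

Lemma join_pdim_col s t a b i : independent s t -> (a + b)%N = n ->
  join_pdim (range (fun j => net s t a b i j)) a%:Z.
Proof.
move=> st abn; rewrite (_ : (fun j => _) = fun j => net t s b a j i).
  by apply: join_pdim_row; [exact: independentC | rewrite addnC].
by apply: funext => j; rewrite netC.
Qed.

Lemma extensive_net s t a b i j :
    independent s t -> (a.+1 + b.+1)%N = n ->
  extensive b.+1 a.+1 i j (net s t a.+1 b.+1).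
Proof.
move=> st abn; have [[pt faces] ndi ndj tri] := nondeg_Qnet_net st abn.
split.
  split; [split | | |] => *; [exact: pt | exact: faces | exact: ndi | exact: ndj
    | exact: tri].
exists fullv; last first.
  by rewrite /pdim dimvf dim_matrix /=; lia.
split=> [A _|W sW]; first exact: subvf.
(* The whole space is the polar of two empty runs, placed at the upper right corner, where growing
   from [(i, j)] ends. *)
have -> : fullv = net s t 0 0 (i + b.+1%:Z) (j + a.+1%:Z).
  by rewrite /net !arc0 addv0 orthov0.
apply: net_growj => // [|l lel]; first by lia.
apply: net_growi => // [|m lem]; first by lia.
apply: sW; exists (i + m%:Z), (j + l%:Z); split=> //.
by rewrite /Sigma; lia.
Qed.

(** * Existence of the transforms and genericity of the grid *)

Lemma laplace_exists_Lplus_net s t a b k : independent s t -> (0 < b)%N ->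
  (a + b)%N = n -> (k <= a)%N -> laplace_exists (@Lplus R n) k (net s t a b).
Proof.
move=> st b_gt0 abn lek l ltl; rewrite iter_Lplus_net //; last by lia.
have -> : (a - l = (a - l).-1.+1)%N by lia.
have -> : (b + l = (b + l).-1.+1)%N by lia.
by apply: nondeg_Qnet_net; [exact: independent_shift | lia].
Qed.

Lemma laplace_exists_Lminus_net s t a b k : independent s t -> (0 < a)%N ->
  (a + b)%N = n -> (k <= b)%N -> laplace_exists (@Lminus R n) k (net s t a b).
Proof.
move=> st a_gt0 abn lek l ltl; rewrite iter_Lminus_net //; last by lia.
have -> : (a + l = (a + l).-1.+1)%N by lia.
have -> : (b - l = (b - l).-1.+1)%N by lia.
apply: nondeg_Qnet_net; last by lia.
exact/independentC/independent_shift/independentC.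
Qed.

Lemma generic_grid_net s t d : independent s t -> (d.+1 + d.+1)%N = n ->
  generic_grid d.+1 (net s t d.+1 d.+1).
Proof.
move=> st dn; split.
- split=> [|j|i]; first by case: (nondeg_Qnet_net st dn).
  + exact: join_pdim_row.
  + exact: join_pdim_col.
- by move=> i j; apply: extensive_net.
- split; first exact: laplace_exists_Lplus_net.
  (* The last transform is the polar of a run of [n] points of [t] alone, which changes with [i]. *)
  move=> i j; rewrite iter_Lplus_net // subnn; apply: net_neqi; try lia.
  exact: independent_shift.
- split; first exact: laplace_exists_Lminus_net.
  move=> i j; rewrite iter_Lminus_net // subnn; apply: net_neqj; try lia.
  exact/independentC/independent_shift/independentC.
Qed.

(** * Inscribed and touching conics *)

Definition isotropic_arcs (s : int -> subspace R n) m :=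
  forall j, (arc s m j <= orthov phi (arc s m j))%VS.

(** Polarization: on the osculating space, [phi (u + v) (u + v)] is twice [phi u v]. *)
Lemma autoconjugate_isotropic s d :
  (forall i, in_quadric phi (osc s (d%:Z - 1) i)) -> isotropic_arcs s d.
Proof.
move=> sQ j; apply/orthovP => u v uA vA.
have zero w : w \in arc s d j -> phi w w = 0 by rewrite -oscE; apply: sQ.
have := zero (u + v) (memvD uA vA).
rewrite linearDl /= !linearDr /= !zero // (form_sym phi v) add0r addr0 -mulr2n.
by move/eqP; rewrite mulrn_eq0 => /eqP.
Qed.

Lemma touches_edge s t d i j : independent s t -> (d.+1 + d.+1)%N = n ->
    isotropic_arcs t d.+1 -> let P := net s t d.+1 d.+1 in
  exists x, touches phi (P i j + P i (j + 1)%R)%VS x.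
Proof.
move=> st dn isot P; rewrite /P net_joinj ?dn // /net.
apply: touches_polar; first exact: isot.
have := st d 0 (j + 1) i; have := st 0 d.+1 (j + 1) i.
rewrite !arc0 addv0 add0v addn0 add0n => -> //; last by lia.
by move=> ->; lia.
Qed.

(** P_1(i,j) is the polar of [arc s d (j + 1) + arc t d.+2 i]. The second run is the join of two
    isotropic runs that both contain [arc t d (i + 1)]. *)
Lemma kernel_in_Lplus s t d i j (P := net s t d.+1 d.+1) : independent s t ->
    (d.+1 + d.+1)%N = n -> isotropic_arcs t d.+1 ->
  (arc t d (i + 1) :&: orthov phi (arc s d (j + 1)) <= Lplus P i j)%VS.
Proof.
move=> st dn isot; rewrite /P Lplus_net // net_shift /net orthov_add capvC.
rewrite capvS // -arc_join orthov_add subv_cap.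
have sub_o i' : (arc t d (i + 1) <= arc t d.+1 i')%VS ->
    (arc t d (i + 1) <= orthov phi (arc t d.+1 i'))%VS.
  by move=> /subv_trans; apply; apply: isot.
by rewrite !sub_o // ?arc_subl ?arc_subr.
Qed.

Lemma inscribed_conic_net s t d i j : independent s t ->
    (d.+1 + d.+1)%N = n -> isotropic_arcs s d.+1 -> isotropic_arcs t d.+1 ->
  inscribed_conic (net s t d.+1 d.+1) i j phi.
Proof.
move=> st dn isos isot; have ts := independentC st.
have edge_j i' j' := touches_edge i' j' st dn isot.
have edge_i i' j' := touches_edge j' i' ts dn isos.
have iso g k : isotropic_arcs g d.+1 ->
    (arc g d k <= orthov phi (arc g d k))%VS.
  move=> isog; apply: subv_trans (arc_subl g d k) (subv_trans (isog k) _).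
  by rewrite orthovS ?arc_subl.
have eqLm : Lminus (net s t d.+1 d.+1) i j = Lplus (net t s d.+1 d.+1) j i.
  by rewrite /Lminus !(netC s t).
have dn1 : (d + d.+2 + 1)%N = n.+1 by lia.
have dimp : \dim (Lplus (net s t d.+1 d.+1) i j) = 1%N.
  by rewrite Lplus_net // net_shift (dim_net _ _ st dn1).
have dimq : \dim (Lminus (net s t d.+1 d.+1) i j) = 1%N.
  by rewrite eqLm Lplus_net // net_shift (dim_net _ _ ts dn1).
(* The face plane is the polar of [A + B]; both are isotropic as parts of longer isotropic runs. *)
set A := arc s d (j + 1); set B := arc t d (i + 1).
have dimAB : \dim (A + B) = (d + d)%N by apply: st; lia.
have dimA : \dim A = d.
  by have := st d 0 (j + 1) i; rewrite arc0 addv0 addn0; apply; lia.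
have dimB : \dim B = d.
  by have := st 0 d j (i + 1); rewrite arc0 add0v add0n; apply; lia.
have AB0 : (A :&: B)%VS = 0%VS.
  apply/eqP; rewrite -dimv_eq0 -(eqn_add2l (\dim (A + B))) dimv_sum_cap.
  by rewrite dimA dimB dimAB addn0.
have dn3 : (d + d + 3)%N = n.+1 by lia.
rewrite /inscribed_conic face_join_net //.
have [|rad0|[pqU dimpq pq_rad nrad]] :=
    @radical_dichotomy _ _ _ phi_nondeg A B _ _ (iso s _ isos) (iso t _ isot)
      AB0 (etrans dimA (esym dimB)) (dim_net _ _ st dn3) dimp dimq
      (kernel_in_Lplus i j st dn isot).
- by rewrite eqLm; apply: kernel_in_Lplus.
- left; split.
    have [x tx] := edge_j i j; apply: (nondeg_quadric_in_radical0 _ tx).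
      by have [_ _ <- _] := net_triples i j st dn; apply: addvSl.
    by rewrite /net orthovK.
  by split; try exact: edge_j; rewrite /tangent !(netC s t); exact: edge_i.
- right; apply: double_line_radical => //.
  by rewrite dimpq (dim_net _ _ st dn3).
Qed.

Lemma koenigs_net_net s t d : independent s t ->
    (d.+1 + d.+1)%N = n -> isotropic_arcs s d.+1 -> isotropic_arcs t d.+1 ->
  koenigs_net Z2 (net s t d.+1 d.+1).
Proof.
move=> st dn isos isot; split; first exact: nondeg_Qnet_net.
exists (fun _ _ => phi); split=> [i j _|i j _ _|i j _ _].
- exact: inscribed_conic_net.
- by have [x] := touches_edge (i + 1) j st dn isot; exists x.
- have [x] := touches_edge (j + 1) i (independentC st) dn isos.
  by rewrite !(netC t s); exists x.
Qed.

Lemma generic_koenigs_grid_net s t d : independent s t -> (0 < d)%N ->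
    (d + d)%N = n -> isotropic_arcs s d -> isotropic_arcs t d ->
  generic_koenigs_grid d (net s t d d).
Proof.
case: d => // d st _ dn isos isot.
by split; [exact: koenigs_net_net | exact: generic_grid_net].
Qed.

End Nets.

Theorem theorem10p5 (R : realType) (d : nat) (d_ge1 : (1 <= d)%N)
    (phi : symform R (2 * d)) (sigma tau : int -> subspace R (2 * d))
    (phi_nondeg : nondeg_quadric phi)
    (sigma_auto : autoconjugate phi sigma)
    (tau_auto : autoconjugate phi tau)
    (st_generic : generic_pair sigma tau) :
  let S := osc sigma in
  let T := osc tau in
  let P := fun i j : int =>
    (orthov phi (S (d%:Z - 1)%R j) :&: orthov phi (T (d%:Z - 1)%R i))%VS in
  let Lp := @Lplus R (2 * d) in
  let Lm := @Lminus R (2 * d) in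
  generic_koenigs_grid d P /\
  forall k : nat, (k <= d)%N ->
    [/\ laplace_exists Lp k P,
        laplace_exists Lm k P &
        forall i j : int,
          iter k Lp P i j =
            (orthov phi (S (d%:Z - k%:Z - 1)%R (j + k%:Z)%R) :&:
             orthov phi (T (d%:Z + k%:Z - 1)%R i))%VS /\
          iter k Lm P i j =
            (orthov phi (T (d%:Z - k%:Z - 1)%R (i + k%:Z)%R) :&:
             orthov phi (S (d%:Z + k%:Z - 1)%R j))%VS].
Proof.
move=> S T P Lp Lm.
have st := generic_pair_independent st_generic.
(* A non-zero vector of the radical would be a singular point of the quadric. *)
have rad0 : orthov phi fullv = 0%VS.
  have [_ [_ nsing]] := phi_nondeg.
  apply/eqP; rewrite -subv0; apply/subvP => u /mem_orthovP uo; rewrite memv0.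
  apply: contraT => u0.
  have [v _] := nsing u (memvf u) u0 (uo u (memvf u)).
  by rewrite uo ?memvf ?eqxx.
have isos := autoconjugate_isotropic sigma_auto.2.
have isot := autoconjugate_isotropic tau_auto.2.
have dd : (d + d)%N = (2 * d)%N by rewrite mul2n addnn.
have {}P_net : P = net phi sigma tau d d.
  by apply: funext => i; apply: funext => j; rewrite /P /net orthov_add -!oscE.
rewrite P_net; split; first exact: generic_koenigs_grid_net.
move=> k lekd; split.
- exact: laplace_exists_Lplus_net.
- exact: laplace_exists_Lminus_net.
- move=> i j; rewrite iter_Lplus_net // iter_Lminus_net // /net !arc_shift.
  (* Run lengths exceed osculating indices by one; for [k = d] the index is -1 and the run is
     empty. *)
  by rewrite /S /T subzn // -PoszD !oscE !orthov_add [X in _ /\ X = _]capvC.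
Qed.
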